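(* Let $X$ be a continuum. If $\mathcal{T}\colon 2^{X}\to 2^{X}$ is continuous, then $\mathcal{D}=\{\mathcal{T}(\{x\}) : x\in X\}$ is a continuous decomposition of $X$ such that the quotient space $X/\mathcal{D}$ is locally connected.
   Context: A continuum is a compact, connected, nonempty metric space; a subcontinuum of $X$ is a subset of $X$ that is a continuum. For a continuum $X$, $2^X$ denotes the set of all nonempty closed subsets of $X$ with the Hausdorff metric. Jones' set function $\mathcal{T}$ is defined for every $A\subseteq X$ by $$\mathcal{T}(A)=X\setminus\{x\in X : \text{there is a subcontinuum } W \text{ of } X \text{ with } x\in W^{\circ}\subseteq W\subseteq X\setminus A\},$$ where $W^\circ$ is the interior of $W$ in $X$. If $A\in 2^X$ then $\mathcal{T}(A)\in 2^X$, and continuity of $\mathcal{T}$ refers to its restriction $2^X\to 2^X$. A decomposition of a topological space $X$ is a family of nonempty, mutually disjoint subsets of $X$ whose union is $X$. A decomposition $\mathcal{G}$ of $X$ is continuous if the quotient map $q\colon X\to X/\mathcal{G}$ is both closed and open. *)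

(* Defs.v *)
From HB Require Import structures.
From mathcomp Require Import all_boot all_order all_algebra.
From mathcomp Require Import all_classical all_reals all_analysis.

Set Implicit Arguments.
Unset Strict Implicit.
Unset Printing Implicit Defensive.
Import Order.TTheory GRing.Theory Num.Theory.
Import numFieldNormedType.Exports.
Local Open Scope classical_set_scope.
Local Open Scope ring_scope.

Section continua.
Context {R : realType} {X : metricType R}.
Implicit Types (A B C W : set X) (e : R).

(* [X] itself is a continuum when [continuum [set: X]]. *)
Definition continuum A : Prop := [/\ compact A, connected A & A !=set0].

Definition jonesT A : set X :=
  ~` [set x | exists W, [/\ continuum W, W° x, W° `<=` W & W `<=` ~` A]].

Definition thickening e A : set X := \bigcup_(a in A) ball a e.

Definition hausdorff_radii A B : set R :=
  [set e | [/\ 0 < e, A `<=` thickening e B & B `<=` thickening e A]].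

Definition hausdorff_dist A B : R := inf (hausdorff_radii A B).

(* The hyperspace [2^X].  It carries the proof that [X] is a continuum because
   [hausdorff_dist] is a metric thanks to the boundedness of [X]. *)
Record hyperspace (X_cont : continuum [set: X]) := Hyperspace {
  hyperspace_set :> set X ;
  hyperspace_closed : closed hyperspace_set ;
  hyperspace_nonempty : hyperspace_set !=set0 }.

End continua.

HB.instance Definition _ (R : realType) (X : metricType R)
  (X_cont : continuum [set: X]) := gen_eqMixin (hyperspace X_cont).
HB.instance Definition _ (R : realType) (X : metricType R)
  (X_cont : continuum [set: X]) := gen_choiceMixin (hyperspace X_cont).

Section hausdorff_metric.
Context {R : realType} {X : metricType R} (X_cont : continuum [set: X]).
Implicit Types (A B C : hyperspace X_cont).

Lemma hyperspace_inj A B : A = B :> set X -> A = B.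
Proof.
case: A B => [A cA A0] [B cB B0] /= AB; subst B.
by congr Hyperspace; exact: Prop_irrelevance.
Qed.

Lemma continuum_bounded (x0 : X) : exists2 M : R, 0 < M & forall x, ball x0 M x.
Proof.
have [+ _ _] := X_cont => /compact_near_coveringP.
move=> /(_ R (+oo)%R (fun M x => ball x0 M x)) /=.
case=> [x _|M0 [_ H]].
  exists (ball x 1, [set M | mdist x0 x + 1 < M]) => /=.
    split; first by apply: nbhsx_ballx; exact: ltr01.
    by apply: nbhs_pinfty_gt; exact: num_real.
  move=> [y M]/=; rewrite !ballEmdist/= => -[xy xM].
  rewrite (le_lt_trans (metric_triangle x0 x y))//.
  by rewrite (lt_trans _ xM)// ltrD2l.
exists (Num.max 1 (M0 + 1)) => [|x]; first by rewrite lt_max ltr01.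
by apply: H => //; rewrite lt_max ltrDl ltr01 orbT.
Qed.

Lemma hausdorff_radii_has_inf A B : has_inf (hausdorff_radii A B).
Proof.
split; last by exists 0 => e [/ltW].
have [a Aa] := hyperspace_nonempty A; have [b Bb] := hyperspace_nonempty B.
have [M M0 aM] := continuum_bounded a.
exists (M + M); split; first by rewrite addr_gt0.
- by move=> x _; exists b => //; exact: ball_triangle (ball_sym (aM b)) (aM x).
- by move=> x _; exists a => //; exact: ball_triangle (ball_sym (aM a)) (aM x).
Qed.

Lemma hausdorff_distxx A : hausdorff_dist A A = 0.
Proof.
apply/eqP; rewrite eq_le; apply/andP; split; last first.
  apply: lb_le_inf; first exact: (hausdorff_radii_has_inf A A).1.
  by move=> e [/ltW].
apply/ler_addgt0Pl => e e0; rewrite addr0; apply: ge_inf.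
  exact: (hausdorff_radii_has_inf A A).2.
by split=> // x Ax; exists x => //; exact: ballxx.
Qed.

Lemma hausdorff_dist_lt A B (e : R) : hausdorff_dist A B < e ->
  (A : set X) `<=` thickening e B.
Proof.
move=> ABe.
have [d [_ AB _] de] := inf_lt (hausdorff_radii_has_inf A B).1 ABe.
by move=> x /AB [b Bb bx]; exists b => //; exact: le_ball (ltW de) _ bx.
Qed.

Lemma hausdorff_dist_sym A B : hausdorff_dist A B = hausdorff_dist B A.
Proof. by congr inf; apply/seteqP; split => e [? ? ?]. Qed.

Lemma hausdorff_dist0 A B : hausdorff_dist A B = 0 -> A = B.
Proof.
suff S C (D : hyperspace X_cont) : hausdorff_dist C D = 0 -> (C : set X) `<=` D.
  move=> AB; apply/hyperspace_inj/seteqP; split; first exact: S.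
  by apply: S; rewrite hausdorff_dist_sym.
move=> CD x Cx; apply: (@hyperspace_closed _ _ _ D) => U /nbhs_ballP[e /= e0 xU].
have /hausdorff_dist_lt/(_ _ Cx)[d Dd dx] : hausdorff_dist C D < e by rewrite CD.
by exists d; split=> //; apply: xU; exact: ball_sym.
Qed.

Lemma hausdorff_dist_triangle B A C :
  hausdorff_dist A C <= hausdorff_dist A B + hausdorff_dist B C.
Proof.
apply/ler_addgt0Pl => e e0.
have e20 : 0 < e / 2 by rewrite divr_gt0.
have [r [r0 ABr BAr] rlt] := inf_adherent e20 (hausdorff_radii_has_inf A B).
have [s [s0 BCs CBs] slt] := inf_adherent e20 (hausdorff_radii_has_inf B C).
apply: (@le_trans _ _ (r + s)).
  apply: ge_inf; first exact: (hausdorff_radii_has_inf A C).2.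
  split; first by rewrite addr_gt0.
  - move=> x /ABr[b /BCs[c Cc cb] bx]; exists c => //.
    by rewrite addrC; exact: ball_triangle cb bx.
  - move=> x /CBs[b /BAr[a Aa ab] bx]; exists a => //.
    exact: ball_triangle ab bx.
by apply: (le_trans (lerD (ltW rlt) (ltW slt))); rewrite addrACA -splitr addrC.
Qed.

HB.instance Definition _ := isMetric.Build R (hyperspace X_cont)
  hausdorff_distxx hausdorff_dist0 hausdorff_dist_sym hausdorff_dist_triangle.

Lemma jonesT_closed (A : set X) : closed (jonesT A).
Proof.
apply: open_closedC; rewrite openE => x [W [Wc Wx WW WA]].
have := @open_interior _ W; rewrite openE => /(_ _ Wx).
by apply: filterS => y Wy; exists W.
Qed.

Lemma subset_jonesT (A : set X) : A `<=` jonesT A.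
Proof. by move=> x Ax [W [_ Wx WW WA]]; exact: (WA x (WW x Wx)) Ax. Qed.

Lemma jonesT_nonempty A : jonesT A !=set0.
Proof.
by have [a Aa] := hyperspace_nonempty A; exists a; exact: subset_jonesT.
Qed.

Definition jonesT_hyperspace A : hyperspace X_cont :=
  Hyperspace X_cont (@jonesT_closed A) (jonesT_nonempty A).

End hausdorff_metric.

Definition decomposition (T : Type) (G : set (set T)) : Prop :=
  partition G id [set: T].

Section decomposition_space.
Context {T : topologicalType} {G : set (set T)} (G_dec : decomposition G).

Definition same_member (x y : T) : bool := `[< exists2 A, G A & A x /\ A y >].

Lemma same_member_refl : reflexive same_member.
Proof.
move=> x; apply/asboolP; have [+ _ _] := G_dec.
by move/seteqP => [_ /(_ x I)[A GA Ax]]; exists A.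
Qed.

Lemma same_member_sym : symmetric same_member.
Proof. by move=> x y; apply: asbool_equiv_eq; split=> -[A ? []]; exists A. Qed.

Lemma same_member_trans : transitive same_member.
Proof.
move=> y x z /asboolP[A GA [Ax Ay]] /asboolP[B GB [By Bz]].
have [_ tG _] := G_dec; have AB : A = B by apply: (tG A B) => //; exists y.
by apply/asboolP; exists A => //; split=> //; rewrite AB.
Qed.

Definition decomposition_equiv : equiv_rel T :=
  EquivRel same_member same_member_refl same_member_sym same_member_trans.

(* The quotient topology on [T / G]: the classes of [same_member] are the
   members of [G]. *)
Definition decomposition_space : topologicalType :=
  quotient_topology {eq_quot decomposition_equiv}%qT.

Definition decomposition_map : T -> decomposition_space :=
  \pi_(quotient_topology {eq_quot decomposition_equiv})%qT.

End decomposition_space.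

Definition open_map (T U : topologicalType) (f : T -> U) : Prop :=
  forall A : set T, open A -> open (f @` A).

Definition closed_map (T U : topologicalType) (f : T -> U) : Prop :=
  forall A : set T, closed A -> closed (f @` A).

Definition continuous_decomposition (T : topologicalType) (G : set (set T))
    (G_dec : decomposition G) : Prop :=
  closed_map (decomposition_map G_dec) /\ open_map (decomposition_map G_dec).

Definition locally_connected (T : topologicalType) : Prop :=
  forall (x : T) (U : set T), open U -> U x ->
    exists V : set T, [/\ open V, connected V, V x & V `<=` U].

(* Main.v *)
Require Import Defs.
From HB Require Import structures.
From mathcomp Require Import all_boot all_order all_algebra.
From mathcomp Require Import all_classical all_reals all_analysis.
From mathcomp Require Import lra.
Import numFieldNormedType.Exports.
Local Open Scope classical_set_scope.
Local Open Scope ring_scope.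

Set Implicit Arguments.
Unset Strict Implicit.
Unset Printing Implicit Defensive.
Import Order.TTheory GRing.Theory Num.Theory.

(* Write t x for T({x}).  Approximating the complement of the interior of a
   subcontinuum W by finite sets disjoint from W, continuity shows that
   T(X \ W°) = X \ W°; hence T is idempotent and "y ∈ t x" is a preorder.

   Symmetry.  The set M of points m such that t m is minimal is closed by
   continuity, and meets every t x by Zorn's lemma.  It is connected because for
   a splitting M = S ⊔ S' the set {x | t x meets S} is clopen.  If x ∉ M, pick
   a ∈ M ∩ t x: for z near a the continuum t z meets M and lies near M, so the
   component of M in a small closed neighborhood of M is a continuum neighborhood
   of a missing x, which contradicts a ∈ t x.  So M = X, and the t x are the
   classes of an equivalence relation; continuity of x ↦ t x makes the quotient
   map closed and open.

   Local connectedness.  Let D be a closed neighborhood of t p such that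
   T(B) ⊆ D for all closed sets B close to t p.  A finite such B whose points lie
   in distinct components of D satisfies T(B) = ⋃_(b ∈ B) t b.  Let A be the set
   of points on a small sphere around t p all of whose neighborhoods meet
   infinitely many components of D.  As A is a limit of such finite sets B, and
   t is symmetric, p ∉ T(A).  This gives a continuum neighborhood L of p missing
   A; by compactness L meets the sphere in only finitely many components of D, and
   these cover L near p, so the component of p in D is a neighborhood of p. *)

(** * Compact and metric spaces *)

Section topology.
Context {T : topologicalType}.
Implicit Types (A B C K S : set T).

(** Induction over compact sets. If [P K] failed, the sets [U] such that [P] holds of [K] minus [U]
    would form a proper filter containing [K]. At a cluster point in [K], a neighborhood satisfying
    [P] has its complement in the filter, which is absurd. *)
Lemma compact_ind (P : set T -> Prop) K : compact K -> P set0 ->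
  (forall A B, P A -> P B -> P (A `|` B)) ->
  (forall A B, A `<=` B -> P B -> P A) ->
  (forall x, K x -> exists2 G, nbhs x G & P G) -> P K.
Proof.
move=> cK P0 PU PS Ploc; apply: contrapT => nPK.
pose F := [set U | P (K `\` U)].
have FF : ProperFilter F.
  split; first by rewrite /F/= setD0.
  split; rewrite /F/=.
  - by rewrite setDT.
  - move=> U V PU' PV'; apply: PS (PU _ _ PU' PV') => x [Kx nUV].
    by have [Ux|nU] := pselect (U x); [right|left]; split=> // Vx; exact: nUV.
  - by move=> U V UV; apply: PS => x [Kx nV]; split=> // /UV.
have FK : F K by rewrite /F/= setDv.
have [x [Kx clx]] := cK F FF FK.
have [G xG PG] := Ploc x Kx.
have FG : F (~` G) by rewrite /F/= setDE setCK; apply: PS PG; exact: subIsetr.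
by have [y []] := clx _ _ FG xG.
Qed.

Lemma connected_sub_closed A S S' : connected A -> closed S -> closed S' ->
  A `<=` S `|` S' -> A `&` S `&` S' = set0 -> (A `&` S) !=set0 -> A `<=` S.
Proof.
move=> cA cS cS' AS AS0 neS.
suff <- : A `&` S = A by exact: subIsetr.
apply: (cA (A `&` S)) => //; last by exists S.
exists (~` S'); first exact: closed_openC.
apply/seteqP; split=> x [Ax Sx]; split=> //.
  by move=> S'x; have : (A `&` S `&` S') x by []; rewrite AS0.
by case: (AS x Ax).
Qed.

Lemma closed_connected A : closed A ->
  (forall S S', closed S -> closed S' -> A = S `|` S' -> S `&` S' = set0 ->
    S !=set0 -> S' = set0) -> connected A.
Proof.
move=> cA H B B0 [C oC BC] [D cD BD].
have cB : closed B by rewrite BD; exact: closedI.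
have cAB : closed (A `\` B).
  rewrite (_ : A `\` B = A `&` ~` C); first exact: (closedI cA (open_closedC oC)).
  rewrite BC; apply/seteqP; split=> x [Ax nB]; split=> // Cx.
    by apply: nB.
  by case: Cx => _ /nB.
have BA : B `<=` A by rewrite BD; exact: subIsetl.
have := H B (A `\` B) cB cAB; rewrite setDUK// setDIK => /(_ erefl erefl B0).
by move=> AB0; apply/seteqP; split=> //; rewrite -setD_eq0.
Qed.

(** The members of [J] missing [p] have a closed union, by finiteness. So near [p] only members
    through [p] remain, and these lie in the component of [p]. *)
Lemma nbhs_component K (J : set (set T)) p : finite_set J ->
  (forall A, J A -> [/\ closed A, connected A & A `<=` K]) ->
  nbhs p (\bigcup_(A in J) A) -> nbhs p (connected_component K p).
Proof.
move=> finJ HJ pJ.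
pose N := \bigcup_(A in J `&` [set A | ~ A p]) A.
have cN : closed N.
  apply: closed_bigcup; last by move=> A [/HJ[]].
  by apply: sub_finite_set finJ; exact: subIsetl.
have pN : nbhs p (~` N).
  apply: open_nbhs_nbhs; split; first exact: closed_openC.
  by move=> [A [_ nA] /nA].
apply: filterS (filterI pJ pN) => z [[A JA Az] nNz].
have [clA coA AK] := HJ _ JA.
have Ap : A p by apply: contrapT => nAp; apply: nNz; exists A.
exact: (connected_component_max Ap AK coA).
Qed.

End topology.

(** * Thickenings, finite nets and boundary bumping *)

Section metric.
Context {R : realType} {X : metricType R}.
Implicit Types (A B C D K L N O P S : set X) (e d : R).

Lemma open_thickening e A : open (thickening e A).
Proof.
apply: bigcup_open => a _; rewrite openE => x; rewrite ballEmdist /= => ax.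
apply/nbhs_ballP; exists (e - mdist a x) => /=; first by rewrite subr_gt0.
move=> y; rewrite !ballEmdist /= ltrBrDl.
by apply: le_lt_trans; exact: metric_triangle.
Qed.

Lemma sub_thickening e A : 0 < e -> A `<=` thickening e A.
Proof. by move=> e0 x Ax; exists x => //; exact: ballxx. Qed.

Lemma thickening_le e d A : e <= d -> thickening e A `<=` thickening d A.
Proof. by move=> ed x [a Aa ax]; exists a => //; exact: le_ball ax. Qed.

Lemma thickeningS e A B : A `<=` B -> thickening e A `<=` thickening e B.
Proof. by move=> AB x [a /AB Ba ax]; exists a. Qed.

Lemma thickeningD e d A : thickening e (thickening d A) `<=` thickening (d + e) A.
Proof.
by move=> x [y [a Aa ay] yx]; exists a => //; exact: ball_triangle ay yx.
Qed.

Lemma closure_thickening e d A : e < d ->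
  closure (thickening e A) `<=` thickening d A.
Proof.
move=> ed x /(_ (ball x (d - e))) [|y [[a Aa ay] xy]].
  by apply: nbhsx_ballx; rewrite subr_gt0.
exists a => //; rewrite -(subrK e d) addrC.
by apply: ball_triangle ay _; exact: ball_sym.
Qed.

Lemma thickening_sub_open C O : compact C -> open O -> C `<=` O ->
  exists2 e, 0 < e & thickening e C `<=` O.
Proof.
move=> cC oO CO.
apply: (@compact_ind _ (fun G => exists2 e, 0 < e & thickening e G `<=` O)) cC _ _ _ _.
- by exists 1 => // x [].
- move=> A B [e e0 eA] [d d0 dB]; exists (Num.min e d); first by rewrite lt_min e0.
  move=> x [y [Ay|By] yx]; [apply: eA|apply: dB]; exists y => //.
    by apply: le_ball yx; rewrite ge_min lexx.
  by apply: le_ball yx; rewrite ge_min lexx orbT.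
- by move=> A B AB [e e0 eB]; exists e => //; exact: subset_trans (thickeningS AB) eB.
- move=> x /CO; move: oO; rewrite openE => /[apply] /nbhs_ballP[e /= e0 xe].
  have e20 : 0 < e / 2 by rewrite divr_gt0.
  exists (ball x (e / 2)); first exact: nbhsx_ballx.
  exists (e / 2) => // z [y xy yz]; apply: xe; rewrite [e]splitr.
  exact: ball_triangle xy yz.
Qed.

Lemma finite_set_closed A : finite_set A -> closed A.
Proof.
have /accessible_finite_set_closed : accessible_space X.
  exact/hausdorff_accessible/metric_hausdorff.
by apply.
Qed.

Hypothesis cX : compact [set: X].

Lemma closed_compactX A : closed A -> compact A.
Proof. by move=> clA; exact: subclosed_compact clA cX _. Qed.

Lemma compact_closedX A : compact A -> closed A.
Proof. by apply: compact_closed; exact: metric_hausdorff. Qed.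

Lemma disjoint_thickening A B : closed A -> closed B -> A `&` B = set0 ->
  exists2 e, 0 < e & thickening e A `&` B = set0.
Proof.
move=> /closed_compactX cA clB AB0.
have [|e e0 eA] := thickening_sub_open cA (closed_openC clB).
  by apply/disjoints_subset.
by exists e => //; apply/disjoints_subset.
Qed.

(** Allows continuity on the hyperspace to be tested on finite sets whose points are taken from a
    prescribed set [P]. *)
Lemma finite_net D P e : closed D -> D `<=` closure P -> 0 < e ->
  exists B, [/\ finite_set B, B `<=` P, D `<=` thickening e B &
    B `<=` thickening e D].
Proof.
move=> clD DP e0.
have [B [fB BP BD DB]] : exists B, [/\ finite_set B, B `<=` P,
    B `<=` thickening e D & D `<=` thickening e B].
  apply: (@compact_ind _ (fun G => exists B, [/\ finite_set B, B `<=` P,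
    B `<=` thickening e D & G `<=` thickening e B])).
  - exact: closed_compactX.
  - by exists set0; split.
  - move=> G G' [B [fB BP BD GB]] [B' [fB' B'P B'D GB']]; exists (B `|` B').
    split; rewrite ?finite_setU ?subUset//; split.
      by apply: (subset_trans GB); apply: thickeningS => x; left.
    by apply: (subset_trans GB'); apply: thickeningS => x; right.
  - by move=> G G' GG' [B [fB BP BD GB]]; exists B; split=> //; exact: subset_trans GB.
  - move=> x Dx; have e20 : 0 < e / 2 by rewrite divr_gt0.
    have [b [Pb xb]] := DP x Dx _ (nbhsx_ballx x _ e20).
    exists (ball x (e / 2)); first exact: nbhsx_ballx.
    exists [set b]; split; first exact: finite_set1.
    + by move=> _ ->.
    + move=> _ ->; exists x => //; apply: le_ball xb.
      by rewrite ler_pdivrMr// ler_pMr// ler1n.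
    + move=> y xy; exists b => //; rewrite [e]splitr.
      exact: ball_triangle (ball_sym xb) xy.
by exists B.
Qed.

(* In a compact space components coincide with quasi-components. *)
Lemma component_cut K B z : closed K -> closed B -> K z ->
  connected_component K z `&` B = set0 ->
  exists S S', [/\ closed S, closed S', K = S `|` S', S `&` S' = set0 &
    S z /\ S `&` B = set0].
Proof.
move=> clK clB Kz zB.
pose clopen S := [/\ closed S, closed (K `\` S), S `<=` K & S z].
pose Q := \bigcap_(S in clopen) S.
have clopenK : clopen K by split=> //; rewrite setDv; exact: closed0.
have QK : Q `<=` K by move=> x /(_ K clopenK).
have clQ : closed Q by apply: closed_bigI => S [].
(* By compactness of the complement of [O], finitely many members of [clopen] already intersect
   inside [O]. *)
have shrink O : open O -> Q `<=` O -> exists2 S, clopen S & S `<=` O.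
  move=> oO QO.
  suff [S cS SO] : exists2 S, clopen S & S `&` ~` O = set0.
    by exists S => //; rewrite -(setCK O); apply/disjoints_subset.
  apply: (@compact_ind _ (fun G => exists2 S, clopen S & S `&` G = set0)
    (~` O)) => /=.
  - by apply: closed_compactX; exact: open_closedC.
  - by exists K => //; rewrite setI0.
  - move=> A A' [S [cS cKS SK Sz] SA] [S' [cS' cKS' S'K S'z] SA'].
    exists (S `&` S').
      split=> //; first exact: closedI.
        by rewrite setDIr; exact: closedU.
      by move=> x [/SK].
    by rewrite setIUr setIAC SA set0I set0U -setIA SA' setI0.
  - move=> A A' AA' [S cS SA']; exists S => //.
    by apply/seteqP; split=> // x [Sx /AA' A'x]; rewrite -SA'.
  - move=> x nOx; have [S cS nSx] : exists2 S, clopen S & ~ S x.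
      apply: contrapT => nS; apply: nOx; apply: QO => S cS.
      by apply: contrapT => nSx; apply: nS; exists S.
    exists (~` S); last by exists S => //; rewrite setICr.
    by apply: open_nbhs_nbhs; split=> //; apply: closed_openC; case: cS.
have Qz : Q z by move=> S [].
have coQ : connected Q.
  apply: closed_connected => //.
  suff main S S' : closed S -> closed S' -> Q = S `|` S' -> S `&` S' = set0 ->
      S z -> S' = set0.
    move=> S S' cS cS' QE SS' [x Sx].
    have := Qz; rewrite QE => -[Sz|S'z]; first exact: (main S S').
    have S0 : S = set0 by apply: (main S' S) => //; rewrite 1?setUC 1?setIC.
    by move: Sx; rewrite S0.
  move=> cS cS' QE SS' Sz.
  have [e e0 eS] := disjoint_thickening cS cS' SS'.
  (* The closure of [U] misses [S']. A set [V] in [clopen] that avoids the boundary of [U] meets [U]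
     in a set that is again in [clopen], so the quasi-component [Q] cannot reach [S']. *)
  pose U := thickening (e / 2) S.
  have e2e : e / 2 < e by rewrite gtr_pMr// invf_lt1// ltr1n.
  have clU : closure U `<=` thickening e S by exact: closure_thickening.
  have [||V [cV cKV VK Vz] VU] := shrink (U `|` ~` closure U).
  - apply: openU; first exact: open_thickening.
    by apply: closed_openC; exact: closed_closure.
  - rewrite QE => x [Sx|S'x]; first by left; apply: sub_thickening => //; rewrite divr_gt0.
    by right=> /clU Ux; have : (thickening e S `&` S') x by []; rewrite eS.
  have VUE : V `&` U = V `&` closure U.
    apply/seteqP; split=> x [Vx Ux]; split=> //; first exact: subset_closure.
    by case: (VU x Vx).
  have cVU : clopen (V `&` U).
    split.
    - by rewrite VUE; apply: closedI => //; exact: closed_closure.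
    - rewrite (_ : K `\` _ = (K `\` V) `|` (K `&` ~` U)).
        apply: closedU => //; apply: closedI => //; apply: open_closedC.
        exact: open_thickening.
      by rewrite setDIr.
    - by move=> x [/VK].
    - by split=> //; apply: sub_thickening => //; rewrite divr_gt0.
  apply/seteqP; split=> // x S'x.
  have Qx : Q x by rewrite QE; right.
  have [_ /subset_closure/clU Ux] := Qx _ cVU.
  by have : (thickening e S `&` S') x by []; rewrite eS.
have Qcomp : Q `<=` connected_component K z by exact: connected_component_max.
have [||S [cS cKS SK Sz] SB] := shrink (~` B); first exact: closed_openC.
  apply/disjoints_subset/seteqP; split=> // x [/Qcomp Cx Bx].
  by rewrite -zB.
exists S, (K `\` S); split=> //; first by rewrite setDUK.
  by rewrite setDIK.
by split=> //; exact/disjoints_subset.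
Qed.

(** Boundary bumping. Otherwise [component_cut] splits the intersection of [L] and [K] into closed
    parts [S] and [S'] with [z] in [S] and [S] inside [N]. Then [S] is separated in [L] from [S']
    together with [L] minus [N], so connectedness puts [L] inside [N]. *)
Lemma component_bump L N K z : closed L -> connected L -> open N -> closed K ->
  N `<=` K -> L z -> N z -> ~ L `<=` N ->
  exists w, [/\ connected_component (L `&` K) z w, L w & ~ N w].
Proof.
move=> clL coL oN clK NK Lz Nz LN; apply: contrapT => H.
have [||||S [S' [clS clS' LKE SS' [Sz SN]]]] :=
    @component_cut (L `&` K) (~` N) z.
- exact: closedI.
- exact: open_closedC.
- by split=> //; exact: NK.
- apply/seteqP; split=> // w [zw nNw]; apply: H; exists w; split=> //.
  by have [] := connected_component_sub zw.
have SL : S `<=` L by move=> x Sx; have [] : (L `&` K) x by rewrite LKE; left.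
have S'L : S' `<=` L by move=> x Sx; have [] : (L `&` K) x by rewrite LKE; right.
have SN' : S `<=` N by rewrite -(setCK N); exact/disjoints_subset.
apply: LN; apply: (subset_trans _ SN').
apply: (@connected_sub_closed _ L S (S' `|` (L `&` ~` N))) => //.
- by apply: closedU => //; apply: closedI => //; exact: open_closedC.
- move=> x Lx; have [Nx|nNx] := pselect (N x); last by right; right.
  have : (L `&` K) x by split=> //; exact: NK.
  by rewrite LKE => -[]; [left|right; left].
- apply/seteqP; split=> // x [[_ Sx] [S'x|[_ nNx]]].
    by rewrite -SS'.
  exact: (nNx (SN' _ Sx)).
- by exists z.
Qed.

End metric.

(** * Jones' set function *)

Section jones.
Context {R : realType} {X : metricType R} (X_cont : continuum [set: X]).
Implicit Types (A B C D K L N O S W : set X) (e d : R) (p x y z : X).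

Let cX : compact [set: X]. Proof. by case: X_cont. Qed.

Lemma not_jonesT A p : ~ jonesT A p ->
  exists W, [/\ continuum W, nbhs p W & W `&` A = set0].
Proof.
move=> /contrapT[W [cW pW _ WA]]; exists W; split=> //.
exact/disjoints_subset.
Qed.

Lemma continuum_not_jonesT A W p : continuum W -> nbhs p W ->
  W `&` A = set0 -> ~ jonesT A p.
Proof.
move=> cW pW WA; apply; exists W; split=> //; first exact: interior_subset.
exact/disjoints_subset.
Qed.

Lemma component_not_jonesT A K p : closed K ->
  nbhs p (connected_component K p) -> K `&` A = set0 -> ~ jonesT A p.
Proof.
move=> clK pK KA; apply: (@continuum_not_jonesT _ (connected_component K p)) => //.
  split; first by apply: closed_compactX => //; exact: component_closed.
    exact: component_connected.
  by exists p; exact: nbhs_singleton.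
apply/seteqP; split=> // x [/connected_component_sub Kx Ax].
by rewrite -KA.
Qed.

Lemma jonesTS A B : A `<=` B -> jonesT A `<=` jonesT B.
Proof.
move=> AB p TA; apply: contrapT => /not_jonesT[W [cW pW WB]].
apply: (continuum_not_jonesT cW pW _ TA).
by apply/seteqP; split=> // x [Wx /AB Bx]; rewrite -WB.
Qed.

Lemma jonesT0 : jonesT (@set0 X) = set0.
Proof.
apply/seteqP; split=> // x.
by apply: (continuum_not_jonesT X_cont); [exact: filterT|exact: setI0].
Qed.

(** Suppose a continuum neighborhood [W] of [p] misses only the part of [A] in [S]. The shell [F]
    around [S] avoids [jonesT A], so finitely many continua missing [A] cover it. Cut [W] down to
    the closure of [N] and add these continua: the result [K] misses [A]. By boundary bumping, every
    point of [W] near [p] is joined in [K] to one of them, so the component of [p] in [K] is a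
    neighborhood of [p]. *)
Lemma jonesT_separated A S S' : closed S -> closed S' ->
  jonesT A = S `|` S' -> S `&` S' = set0 -> S `<=` jonesT (A `&` S).
Proof.
move=> clS clS' TE SS' p Sp; apply: contrapT => /not_jonesT[W [cW pW WA]].
have [e e0 eS] := disjoint_thickening cX clS clS' SS'.
pose N := thickening (e / 2) S.
have e20 : 0 < e / 2 by rewrite divr_gt0.
have SN : S `<=` N by exact: sub_thickening.
have NS' : closure N `&` S' = set0.
  apply/seteqP; split=> // x [Nx S'x]; rewrite -eS; split=> //.
  by apply: closure_thickening Nx; rewrite gtr_pMr// invf_lt1// ltr1n.
have oN : open N by exact: open_thickening.
pose F := closure N `\` N.
have clF : closed F.
  by apply: closedI; [exact: closed_closure|exact: open_closedC].
have [I [finI HI FI]] : exists I : set (set X), [/\ finite_set I,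
    (forall Z, I Z -> continuum Z /\ Z `&` A = set0) &
    F `<=` \bigcup_(Z in I) Z].
  apply: (@compact_ind _ (fun G => exists I : set (set X), [/\ finite_set I,
      (forall Z, I Z -> continuum Z /\ Z `&` A = set0) &
      G `<=` \bigcup_(Z in I) Z])).
  - exact: closed_compactX.
  - by exists set0; split.
  - move=> G G' [I [fI HI GI]] [I' [fI' HI' GI']]; exists (I `|` I'); split.
    + by rewrite finite_setU.
    + by move=> Z [/HI|/HI'].
    + by rewrite bigcup_setU; exact: setUSS.
  - by move=> G G' GG' [I [fI HI GI]]; exists I; split=> //; exact: subset_trans GI.
  - move=> x [Nx nNx].
    have [Z [cZ xZ ZA]] : exists W, [/\ continuum W, nbhs x W & W `&` A = set0].
      apply: not_jonesT; rewrite TE => -[/SN//|S'x].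
      by have : (closure N `&` S') x by []; rewrite NS'.
    exists Z => //; exists [set Z]; split; first exact: finite_set1.
      by move=> _ ->.
    by rewrite bigcup_set1.
have Wclosed : closed W by case: cW => /(compact_closedX).
pose K := (W `&` closure N) `|` \bigcup_(Z in I) Z.
have clK : closed K.
  apply: closedU; first by apply: closedI => //; exact: closed_closure.
  by apply: closed_bigcup => // Z /HI[[/compact_closedX]].
have KA : K `&` A = set0.
  apply/seteqP; split=> // x [[[Wx Nx]|[Z /HI[_ ZA] Zx]] Ax]; last by rewrite -ZA.
  have : (S `|` S') x by rewrite -TE; exact: subset_jonesT.
  move=> [Sx|S'x]; first by rewrite -WA.
  by rewrite -NS'.
have [WN|nWN] := pselect (W `<=` N).
  have : jonesT A p by rewrite TE; left.
  apply: continuum_not_jonesT cW pW _.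
  apply/seteqP; split=> // x [Wx Ax]; rewrite -KA; split=> //; left.
  by split=> //; apply: subset_closure; exact: WN.
have : jonesT A p by rewrite TE; left.
apply: (component_not_jonesT clK _ KA).
(* Each [Z] in [I] is a continuum, hence nonempty, so [xget p Z] is a point of [Z] and its component
   contains [Z]. *)
apply: (@nbhs_component _ _ ((fun Z => connected_component K (xget p Z)) @` I)).
- exact: finite_image.
- move=> _ [Z _ <-]; split; first exact: component_closed.
    exact: component_connected.
  exact: connected_component_sub.
- have : nbhs p N by apply: open_nbhs_nbhs; split=> //; exact: SN.
  move/(filterI pW); apply: filterS => z [Wz Nz].
  have [cpW coW _] := cW.
  have [w [zw Ww nNw]] := component_bump cX Wclosed coW oN
    (@closed_closure _ N) (@subset_closure _ N) Wz Nz nWN.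
  have [_ Nw] := connected_component_sub zw.
  have [Z IZ Zw] := FI w (conj Nw nNw).
  have [[_ coZ _] _] := HI _ IZ.
  have ZK : Z `<=` K by move=> u Zu; right; exists Z.
  exists (connected_component K (xget p Z)); first by exists Z.
  have xZ : Z (xget p Z) by exact: xgetPex (ex_intro _ w Zw).
  apply: (@connected_component_trans _ _ w).
    exact: (connected_component_max xZ ZK coZ).
  apply: (connected_component_max (B := connected_component (W `&` closure N) z)) => //.
    by move=> u /connected_component_sub ?; left.
  - exact: component_connected.
  - by apply: connected_component_refl; split=> //; exact: subset_closure.
Qed.

(** In a splitting with [x] in [S], [jonesT_separated] puts [S'] inside the image of the empty set,
    which is empty. *)
Lemma jonesT1_connected x : connected (jonesT [set x]).
Proof.
apply: closed_connected; first exact: jonesT_closed.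
suff main S S' : closed S -> closed S' -> jonesT [set x] = S `|` S' ->
    S `&` S' = set0 -> S x -> S' = set0.
  move=> S S' cS cS' TE SS' [y Sy].
  have : jonesT [set x] x by exact: subset_jonesT.
  rewrite TE => -[Sx|S'x]; first exact: (main S S').
  have S0 : S = set0 by apply: (main S' S) => //; rewrite 1?setUC 1?setIC.
  by move: Sy; rewrite S0.
move=> cS cS' TE SS' Sx; apply/seteqP; split=> //.
rewrite -jonesT0.
have := @jonesT_separated [set x] S' S cS' cS; rewrite setUC setIC => /(_ TE SS').
move/subset_trans; apply; apply: jonesTS => y [-> S'x].
by rewrite -SS'.
Qed.

End jones.

(** * Consequences of continuity: idempotence, minimal points and symmetry *)

Section continuous_jones.
Context {R : realType} {X : metricType R} (X_cont : continuum [set: X]).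
Hypothesis T_cont : continuous (@jonesT_hyperspace R X X_cont).
Implicit Types (A B C D K L N O S W : set X) (e d : R) (m p x y z : X).

Let cX : compact [set: X]. Proof. by case: X_cont. Qed.

Lemma jonesT_modulus A e : closed A -> A !=set0 -> 0 < e ->
  exists2 d, 0 < d & forall B, closed B -> A `<=` thickening d B ->
    B `<=` thickening d A ->
    jonesT A `<=` thickening e (jonesT B) /\
    jonesT B `<=` thickening e (jonesT A).
Proof.
move=> clA A0 e0; pose HA := Hyperspace X_cont clA A0.
have /nbhs_ballP[d /= d0 dP] := T_cont (nbhsx_ballx (jonesT_hyperspace HA) e e0).
have d20 : 0 < d / 2 by rewrite divr_gt0.
exists (d / 2) => // B clB AB BA.
have B0 : B !=set0 by have [a /AB[b Bb _]] := A0; exists b.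
pose HB := Hyperspace X_cont clB B0.
have dAB : hausdorff_dist HA HB < d.
  apply: (@le_lt_trans _ _ (d / 2)); last by rewrite gtr_pMr// invf_lt1// ltr1n.
  by apply: ge_inf; [exact: (hausdorff_radii_has_inf HA HB).2|split].
have eAB : hausdorff_dist (jonesT_hyperspace HA) (jonesT_hyperspace HB) < e.
  have : ball HA d HB by rewrite ballEmdist.
  by move/dP; rewrite /= ballEmdist.
split; first exact: (hausdorff_dist_lt eAB).
by rewrite hausdorff_dist_sym in eAB; exact: (hausdorff_dist_lt eAB).
Qed.

(* [~` W°] is a limit of finite sets disjoint from [W], whose images under
   [jonesT] avoid [W°]. *)
Lemma jonesT_interiorC W : continuum W -> jonesT (~` W°) `<=` ~` W°.
Proof.
move=> cW p Tp Wp.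
have clD : closed (~` W°) by apply: open_closedC; exact: open_interior.
have [D0|/set0P D0] := eqVneq (~` W°) set0.
  by move: Tp; rewrite D0 (jonesT0 X_cont).
have /nbhs_ballP[e /= e0 pe] : nbhs p W°.
  by apply: open_nbhs_nbhs; split=> //; exact: open_interior.
have [d d0 dP] := jonesT_modulus clD D0 e0.
have [B [fB BW DB BD]] : exists B, [/\ finite_set B, B `<=` ~` W,
    ~` W° `<=` thickening d B & B `<=` thickening d (~` W°)].
  by apply: finite_net => //; rewrite -[W in ~` W°]setCK interiorC setCK.
have [/(_ _ Tp)[y By yp] _] := dP B (finite_set_closed fB) DB BD.
apply: (@continuum_not_jonesT _ _ B W y cW) By.
  by apply: pe; exact: ball_sym.
by rewrite setIC; apply/disjoints_subset.
Qed.

(** A continuum [W] missing [A] shows that its whole interior avoids [jonesT A]; then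
    [jonesT_interiorC] applies to [W]. *)
Lemma jonesT_idem A : jonesT (jonesT A) `<=` jonesT A.
Proof.
move=> p TTp; apply: contrapT => /not_jonesT[W [cW pW WA]].
have : jonesT (~` W°) p.
  apply: jonesTS TTp => y Ty Wy.
  exact: (continuum_not_jonesT cW Wy WA Ty).
by move/(jonesT_interiorC cW); exact.
Qed.

Local Notation t x := (jonesT [set x]).

Lemma jonesT1_refl x : t x x.
Proof. exact: subset_jonesT. Qed.

Lemma jonesT1_trans x y : t x y -> t y `<=` t x.
Proof. by move=> xy z yz; apply: jonesT_idem; apply: jonesTS yz => _ ->. Qed.

Lemma jonesT1_modulus x e : 0 < e -> exists2 d, 0 < d & forall z, ball x d z ->
  t x `<=` thickening e (t z) /\ t z `<=` thickening e (t x).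
Proof.
move=> e0; have [|d d0 dP] := @jonesT_modulus [set x] e _ (ex_intro _ x erefl) e0.
  by apply: finite_set_closed; exact: finite_set1.
exists d => // z xz; apply: dP; first by apply: finite_set_closed; exact: finite_set1.
  by move=> _ ->; exists z => //; exact: ball_sym.
by move=> _ ->; exists x.
Qed.

(** Upper semicontinuity of the map sending [x] to [t x]; it will make the quotient map closed. *)
Lemma closed_jonesT1_meets S : closed S -> closed [set x | (t x `&` S) !=set0].
Proof.
move=> clS x xcl; apply: contrapT => /nonemptyPn tS.
have [e e0 eS] := disjoint_thickening cX (@jonesT_closed _ _ [set x]) clS tS.
have [d d0 dP] := jonesT1_modulus x e0.
have [z [[w [zw Sw]] /dP[_ /(_ _ zw) xw]]] := xcl _ (nbhsx_ballx x d d0).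
by have : (thickening e (t x) `&` S) w by []; rewrite eS.
Qed.

(** Lower semicontinuity of the same map; it will make the quotient map open. *)
Lemma open_jonesT1_meets O : open O -> open [set x | (t x `&` O) !=set0].
Proof.
move=> oO; rewrite openE => x [w [xw Ow]].
have /nbhs_ballP[e /= e0 we] : nbhs w O by exact: open_nbhs_nbhs.
have [d d0 dP] := jonesT1_modulus x e0.
apply/nbhs_ballP; exists d => // z /dP[/(_ _ xw)[y zy yw] _].
by exists y; split=> //; apply: we; exact: ball_sym.
Qed.

Definition jonesT1_minimal : set X := [set m | forall y, t m y -> t y m].
Local Notation M := jonesT1_minimal.

(** Zorn's lemma on the points of [t x]: along a chain the closed sets [t u] are nested, so by
    compactness they share a point, which bounds the chain. *)
Lemma jonesT1_meets_minimal x : (t x `&` M) !=set0.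
Proof.
pose I := {y | t x y}; pose r (u v : I) := `[< t (sval u) (sval v) >].
pose x0 : I := exist (t x) x (@jonesT1_refl x).
have [|u v w /asboolP uv /asboolP vw|A totA|[m xm] /= mmax] :=
    @ZL_preorder I x0 r.
- by move=> u; apply/asboolP; exact: jonesT1_refl.
- by apply/asboolP; exact: (jonesT1_trans uv).
- have [[a Aa]|A0] := pselect (A !=set0); last first.
    exists x0 => s As.
    by exfalso; apply: A0; exists s.
  pose F := filter_from A (fun u => t (sval u)).
  have FF : ProperFilter F.
    apply: filter_from_proper; last first.
      by move=> u _; exists (sval u); exact: jonesT1_refl.
    apply: filter_from_filter; first by exists a.
    move=> u v Au Av; have [/asboolP uv|/asboolP vu] := totA u v Au Av.
      exists v => // z vz; split=> //; exact: (jonesT1_trans uv).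
    exists u => // z uz; split=> //; exact: (jonesT1_trans vu).
  have [z [_ zF]] := cX FF filterT.
  have zA u : A u -> t (sval u) z.
    move=> Au; apply: (@jonesT_closed _ _ [set sval u]) => U zU.
    by apply: zF => //; exists u.
  have xz : t x z by apply: (jonesT1_trans (svalP a)); exact: zA.
  by exists (exist (t x) z xz) => u Au; apply/asboolP; exact: zA.
- exists m; split=> // y my.
  have xy : t x y by exact: (jonesT1_trans xm).
  by apply/asboolP; apply: (mmax (exist (t x) y xy)); apply/asboolP.
Qed.

Lemma sub_jonesT1_minimal m : M m -> t m `<=` M.
Proof.
move=> Mm y my z yz; apply: (@jonesT1_trans z m) => //; apply: Mm.
exact: (jonesT1_trans my).
Qed.

(** For [y] in [t m], a minimal [m'] near [m] has some [y'] in [t m'] near [y]. Minimality gives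
    [m'] in [t y'], so continuity at [y] yields points of [t y] near [m'], hence near [m]. *)
Lemma jonesT1_minimal_closed : closed M.
Proof.
move=> m mcl y my; apply: (@jonesT_closed _ _ [set y]) => U.
move=> /nbhs_ballP[e /= e0 mU]; have e20 : 0 < e / 2 by rewrite divr_gt0.
have [d d0 dP] := jonesT1_modulus y e20.
have [c c0 cP] := jonesT1_modulus m d0.
have k0 : 0 < Num.min c (e / 2) by rewrite lt_min c0.
have [m' [Mm' mm']] := mcl _ (nbhsx_ballx m _ k0).
have mcm' : ball m c m' by apply: le_ball mm'; rewrite ge_min lexx.
have mem' : ball m (e / 2) m' by apply: le_ball mm'; rewrite ge_min lexx orbT.
have [/(_ _ my)[y' m'y' y'y] _] := cP _ mcm'.
have [_ /(_ _ (Mm' _ m'y'))[w yw wm']] := dP _ (ball_sym y'y).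
exists w; split=> //; apply: mU; rewrite [e]splitr.
exact: ball_triangle mem' (ball_sym wm').
Qed.

Lemma jonesT1_minimal_connected : connected M.
Proof.
have main S S' : closed S -> closed S' -> M = S `|` S' -> S `&` S' = set0 ->
    S !=set0 -> (forall m, S m -> t m `<=` S) /\ forall x, (t x `&` S) !=set0.
  move=> clS clS' ME SS' [s Ss].
  have tS m : S m -> t m `<=` S.
    move=> Sm; apply: (@connected_sub_closed _ (t m) S S') => //.
    - exact: (jonesT1_connected X_cont).
    - by rewrite -ME; apply: sub_jonesT1_minimal; rewrite ME; left.
    - by rewrite -setIA SS' setI0.
    - by exists m; split=> //; exact: jonesT1_refl.
  split=> // x; pose U := [set x | (t x `&` S) !=set0].
  suff UT : U = [set: X] by have : U x by rewrite UT.
  have [_ coX _] := X_cont; apply: coX.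
  - by exists s; exists s; split=> //; exact: jonesT1_refl.
  - exists U; last by rewrite setTI.
    (* Openness of [U]: for [z] near [y], [t z] has a point [w] near [m]. As [t w] stays near [t m],
       which lies in [S], its minimal points cannot be in [S']. *)
    rewrite openE => y [m [ym Sm]].
    have [e e0 eS] := disjoint_thickening cX clS clS' SS'.
    have [d d0 dP] := jonesT1_modulus m e0.
    have : nbhs y [set z | (t z `&` thickening d [set m]) !=set0].
      apply: open_nbhs_nbhs; split.
        by apply: open_jonesT1_meets; exact: open_thickening.
      by exists m; split=> //; apply: sub_thickening.
    apply: filterS => z [w [zw [_ -> /dP[_ twm]]]].
    have [m' [wm' Mm']] := jonesT1_meets_minimal w.
    exists m'; split; first exact: (jonesT1_trans zw).
    move: Mm'; rewrite ME => -[//|S'm'].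
    have : (thickening e S `&` S') m'.
      by split=> //; apply: (thickeningS (tS m Sm)); exact: twm.
    by rewrite eS.
  - exists U; last by rewrite setTI.
    exact: closed_jonesT1_meets.
apply: closed_connected; first exact: jonesT1_minimal_closed.
move=> S S' clS clS' ME SS' S0; apply/seteqP; split=> // s S's.
have [_ H] := main S' S clS' clS (etrans ME (setUC _ _)) (etrans (setIC _ _) SS')
  (ex_intro _ s S's).
have [tS _] := main S S' clS clS' ME SS' S0.
have [m Sm] := S0; have [w [mw S'w]] := H m.
have : (S `&` S') w by split=> //; exact: tS mw.
by rewrite SS'.
Qed.

Lemma jonesT1_minimalT x : M x.
Proof.
apply: contrapT => nMx.
have /nbhs_ballP[r /= r0 xr] : nbhs x (~` M).
  apply: open_nbhs_nbhs; split=> //; apply: closed_openC.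
  exact: jonesT1_minimal_closed.
have r20 : 0 < r / 2 by rewrite divr_gt0.
have [a [xa Ma]] := jonesT1_meets_minimal x.
pose D := ~` thickening (r / 2) [set x].
have clD : closed D by apply: open_closedC; exact: open_thickening.
have MD : M `<=` D.
  move=> m Mm [_ -> xm]; apply: (xr m) => //; apply: le_ball xm.
  by rewrite ler_pdivrMr// ler_pMr// ler1n.
apply: (component_not_jonesT X_cont clD _ _ xa).
  (* For [z] near [a], points of [t z] are within [r / 2] of [M], which is at distance at least [r]
     from [x]; hence they stay in [D]. *)
  have [d d0 dP] := jonesT1_modulus a r20.
  apply/nbhs_ballP; exists d => // z /dP[_ za].
  apply: (@connected_component_max _ _ (t z `|` M)).
  - by right.
  - rewrite subUset; split=> // w /za[b ab bw] [_ -> xw].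
    apply: (xr b); last exact: sub_jonesT1_minimal ab.
    by rewrite [r]splitr; exact: ball_triangle xw (ball_sym bw).
  - apply: connectedU; first exact: jonesT1_meets_minimal.
      exact: (jonesT1_connected X_cont).
    exact: jonesT1_minimal_connected.
  - by left; exact: jonesT1_refl.
by apply/seteqP; split=> // z [Dz zx]; case: Dz; exact: sub_thickening.
Qed.

Lemma jonesT1_sym x y : t x y -> t y x.
Proof. exact: jonesT1_minimalT. Qed.

Lemma jonesT1_eq x y : t x y -> t x = t y.
Proof.
move=> xy; apply/seteqP; split; last exact: jonesT1_trans.
by apply: jonesT1_trans; exact: jonesT1_sym.
Qed.

End continuous_jones.

(** * The decomposition space *)

Section local_connectedness.
Context {R : realType} {X : metricType R} (X_cont : continuum [set: X]).
Hypothesis T_cont : continuous (@jonesT_hyperspace R X X_cont).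
Implicit Types (A B C D K L N O S W : set X) (e d : R) (m p x y z : X).

Let cX : compact [set: X]. Proof. by case: X_cont. Qed.

Local Notation t x := (jonesT [set x]).

(** Cut [jonesT B] between the component [C] of [y] and the points of [B] outside [C]. By
    [jonesT_separated], only points of [B] in [C] matter for [y]; [C] lies in one component of [D],
    so there is just one such point. *)
Lemma jonesT_finite_components B D y : closed D -> jonesT B `<=` D ->
  finite_set B ->
  (forall b b', B b -> B b' -> connected_component D b b' -> b = b') ->
  jonesT B y -> exists2 b, B b & t b y.
Proof.
move=> clD TBD fB Bdist TBy; pose K := jonesT B.
have clK : closed K by exact: jonesT_closed.
pose C := connected_component K y.
have [||//||S [S' [clS clS' KE SS' [Sy SB]]]] :=
    @component_cut _ _ cX K (B `\` C) y.
- exact: clK.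
- by apply: finite_set_closed; exact: finite_setD.
- by rewrite setDIK.
have Ty : jonesT (B `&` S) y by exact: (jonesT_separated X_cont clS clS' KE SS').
have BSC b : B b -> S b -> C b.
  move=> Bb Sb; apply: contrapT => nCb.
  by have : (S `&` (B `\` C)) b by []; rewrite SB.
have [BS0|/set0P[b [Bb Sb]]] := eqVneq (B `&` S) set0.
  by move: Ty; rewrite BS0 (jonesT0 X_cont).
exists b => //; apply: jonesTS Ty => b' [Bb' Sb'] /=.
apply: Bdist => //; apply: (@connected_component_max _ D C) => //.
- exact: BSC.
- by apply: (subset_trans _ TBD); exact: connected_component_sub.
- exact: component_connected.
- exact: BSC.
Qed.

Definition component_accumulation D : set X := [set e | forall G, nbhs e G ->
  infinite_set (connected_component D @` (G `&` D))].

Lemma component_accumulation_closed D : closed (component_accumulation D).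
Proof.
move=> e ecl G /nbhs_interior eG; have [x [Ex Gx]] := ecl _ eG.
exact: Ex.
Qed.

(** Greedy choice: near each point of [s] there are infinitely many components of [D], so one not
    yet used is available. The result is a set to which [jonesT_finite_components] applies. *)
Lemma spread_components D (s : seq X) d : 0 < d ->
  (forall x, x \in s -> component_accumulation D x) ->
  exists B, [/\ finite_set B, B `<=` D,
    forall x, x \in s -> exists2 b, B b & ball x d b,
    forall b, B b -> exists2 x, x \in s & ball x d b &
    forall b b', B b -> B b' -> connected_component D b b' -> b = b'].
Proof.
move=> d0; elim: s => [_|x s IH sD]; first by exists set0; split.
have [|B [fB BD sB Bs Bdist]] := IH.
  by move=> y ys; apply: sD; rewrite inE ys orbT.
have [g [xg Dg gB]] : exists g, [/\ ball x d g, D g &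
    ~ (connected_component D @` B) (connected_component D g)].
  apply: contrapT => H; apply: (sD x (mem_head _ _) (ball x d)).
    exact: nbhsx_ballx.
  apply: sub_finite_set (finite_image (connected_component D) fB).
  move=> _ [g [xg Dg] <-]; apply: contrapT => nB; apply: H.
  by exists g; split.
exists (g |` B); split.
- by rewrite finite_setU; split=> //; exact: finite_set1.
- by move=> y [->|/BD].
- move=> y; rewrite inE => /orP[/eqP ->|/sB[b Bb yb]]; last by exists b => //; right.
  by exists g => //; left.
- move=> b [->|/Bs[y ys yb]]; first by exists x => //; exact: mem_head.
  by exists y => //; rewrite inE ys orbT.
- move=> b b' [->|Bb] [->|Bb'] bb' //.
  + by exfalso; apply: gB; exists b' => //; rewrite (same_connected_component bb').
  + by exfalso; apply: gB; exists b => //; rewrite (same_connected_component bb').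
  + exact: Bdist.
Qed.

Lemma nbhs_connected_component O p : open O -> t p `<=` O ->
  nbhs p (connected_component O p).
Proof.
move=> oO pO; pose C := t p.
have clC : closed C by exact: jonesT_closed.
have [e e0 eO] := thickening_sub_open (closed_compactX cX clC) oO pO.
have e20 : 0 < e / 2 by rewrite divr_gt0.
pose D := closure (thickening (e / 2) C).
have clD : closed D by exact: closed_closure.
have DO : D `<=` O.
  by apply: (subset_trans _ eO); apply: closure_thickening; lra.
have Cp : C p by exact: subset_jonesT.
have [h' h'0 h'P] := jonesT_modulus T_cont clC (ex_intro _ p Cp) e20.
(* Adding [C] to [B] turns one-sided closeness into Hausdorff closeness; idempotence bounds the
   image of [C] by [C]. *)
have TD B : closed B -> B `<=` thickening h' C -> jonesT B `<=` D.
  move=> clB BC; have [||_] := h'P (B `|` C) (closedU clB clC).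
  - by move=> x Cx; exists x; [right|exact: ballxx].
  - by rewrite subUset; split=> //; exact: sub_thickening.
  - move=> TBC; apply: (subset_trans (jonesTS (@subsetUl _ B C))).
    apply: (subset_trans TBC); apply: (subset_trans _ (@subset_closure _ _)).
    by apply: thickeningS; exact: jonesT_idem.
(* Radius [3 h] keeps the closure of [N] inside [D]; radius [4 h] lets sets within [h] of that
   closure still satisfy [TD]. *)
pose h := Num.min h' (e / 2) / 4.
have h0 : 0 < h by rewrite divr_gt0// lt_min h'0.
have hh' : (h + h + h) + h <= h'.
  have : Num.min h' (e / 2) <= h' by rewrite ge_min lexx.
  by rewrite /h; lra.
have he : (h + h + h) <= e / 2.
  have : Num.min h' (e / 2) <= e / 2 by rewrite ge_min lexx orbT.
  by move: h0; rewrite /h; lra.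
pose N := thickening (h + h) C.
have oN : open N by exact: open_thickening.
have NK : closure N `<=` thickening (h + h + h) C.
  by apply: closure_thickening; lra.
have KD : closure N `<=` D.
  apply: (subset_trans NK); apply: (subset_trans (thickening_le he)).
  exact: subset_closure.
have Np : N p by apply: sub_thickening => //; lra.
pose F := closure N `\` N.
have clF : closed F.
  by apply: closedI; [exact: closed_closure|exact: open_closedC].
pose A := component_accumulation D `&` F.
have clA : closed A by apply: closedI => //; exact: component_accumulation_closed.
have nTA : ~ jonesT A p.
  move=> TA; have [A0|/set0P A0] := eqVneq A set0.
    by move: TA; rewrite A0 (jonesT0 X_cont).
  have [c c0 cP] := jonesT1_modulus T_cont p h0.
  have [d d0 dP] := jonesT_modulus T_cont clA A0 c0.
  (* The net [s] is [k]-close to [A] and spreading moves each point by less than [k], so [B] is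
     [2 k]-close to [A], which [d] allows. *)
  pose k := Num.min d h / 2.
  have k0 : 0 < k by rewrite divr_gt0// lt_min d0.
  have kd : k + k <= d.
    have : Num.min d h <= d by rewrite ge_min lexx.
    by rewrite /k; lra.
  have kh : k <= h.
    have : Num.min d h <= h by rewrite ge_min lexx orbT.
    by move: k0; rewrite /k; lra.
  have [B0 [/finite_seqP[s ->] sA As _]] :=
    finite_net cX clA (@subset_closure _ A) k0.
  have [|B [fB BD sB Bs Bdist]] := @spread_components D s k k0.
    by move=> x /sA[].
  have BA b : B b -> exists2 f, A f & ball f k b.
    by move=> /Bs[x xs xb]; exists x => //; exact: sA.
  have clB := finite_set_closed fB.
  have [||/(_ _ TA)[y TBy yp] _] := dP B clB.
  - apply: (subset_trans _ (thickening_le kd)).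
    move=> x /As[x' /sB[b Bb x'b] x'x]; exists b => //.
    exact: ball_triangle (ball_sym x'b) x'x.
  - have kd' : k <= d by lra.
    by apply: (subset_trans _ (thickening_le kd')) => b /BA[f Af fb]; exists f.
  have TBD : jonesT B `<=` D.
    apply: TD => //; apply: (subset_trans _ (thickening_le hh')).
    apply: (subset_trans _ (@thickeningD _ _ _ _ _)).
    move=> b /BA[f [_ [/NK Nf _]] fb]; exists f => //.
    exact: le_ball fb.
  have [b Bb bTy] := jonesT_finite_components clD TBD fB Bdist TBy.
  (* Symmetry puts [b] in [t y], which is [h]-close to [t p] as [y] is near [p]. Then [f], within
     [h] of [b], is within [2 h] of [t p], although it lies outside [N]. *)
  have [_ /(_ b)] := cP _ (ball_sym yp).
  move=> /(_ (jonesT1_sym T_cont bTy)) hb.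
  have [f [_ [_ nNf]] fb] := BA b Bb; apply: nNf.
  apply: thickeningD; exists b => //.
  by apply: ball_sym; exact: le_ball fb.
have [L [[cpL coL _] pL LA]] := not_jonesT nTA.
have clL := compact_closedX cpL.
suff pD : nbhs p (connected_component D p).
  apply: filterS pD; apply: connected_component_max.
  - by apply: connected_component_refl; apply: KD; exact: subset_closure.
  - by apply: (subset_trans _ DO); exact: connected_component_sub.
  - exact: component_connected.
have [LN|nLN] := pselect (L `<=` N).
  have Lp := nbhs_singleton pL.
  apply: filterS pL; apply: connected_component_max => //.
  by apply: (subset_trans LN); apply: (subset_trans _ KD); exact: subset_closure.
apply: (@nbhs_component _ D (connected_component D @` (L `&` F `&` D))).
(* Finiteness is local: [L] misses [A], so each point of [L] in the shell [F] has a neighborhood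
   meeting finitely many components of [D]. *)
- apply: (@compact_ind _ (fun G => finite_set (connected_component D @` (G `&` D)))).
  + by apply: closed_compactX => //; exact: closedI.
  + by rewrite set0I image_set0.
  + by move=> G G' fG fG'; rewrite setIUl image_setU finite_setU.
  + by move=> G G' GG'; apply: sub_finite_set; apply: image_subset; exact: setSI.
  + move=> x [Lx Fx]; apply: contrapT => H.
    suff : (L `&` A) x by rewrite LA.
    split=> //; split=> // G xG fG; apply: H; exists G => //.
- move=> _ [w _ <-]; split; first exact: component_closed.
    exact: component_connected.
  exact: connected_component_sub.
- have : nbhs p N by exact: open_nbhs_nbhs.
  move/(filterI pL); apply: filterS => z [Lz Nz].
  have [w [zw Lw nNw]] := component_bump cX clL coL oN
    (@closed_closure _ N) (@subset_closure _ N) Lz Nz nLN.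
  have [_ Nw] := connected_component_sub zw.
  exists (connected_component D w); first by exists w; split=> //; exact: KD.
  apply: connected_component_sym.
  apply: (@connected_component_max _ D (connected_component (L `&` closure N) z)) => //.
  + by apply: connected_component_refl; split=> //; exact: subset_closure.
  + by move=> u /connected_component_sub[_ /KD].
  + exact: component_connected.
Qed.

End local_connectedness.

(** * The quotient map and the quotient space *)

Section quotient.
Context {R : realType} {X : metricType R} (X_cont : continuum [set: X]).
Hypothesis T_cont : continuous (@jonesT_hyperspace R X X_cont).

Local Notation t x := (jonesT [set x]).
Local Notation G := (range (fun x : X => t x)).

Lemma jonesT1_decomposition : decomposition G.
Proof.
split.
- apply/seteqP; split=> // x _; exists (t x); last exact: subset_jonesT.
  by exists x.
- move=> _ _ [x _ <-] [y _ <-] [z [xz yz]] /=.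
  by rewrite (jonesT1_eq T_cont xz) (jonesT1_eq T_cont yz).
- by move=> _ [x _ <-]; exists x; exact: subset_jonesT.
Qed.

Variable G_dec : decomposition G.
Local Notation q := (decomposition_map G_dec).

Lemma decomposition_map_eq (x y : X) : q x = q y <-> t x y.
Proof.
have sameE : @same_member X G x y <-> t x y.
  split=> [/asboolP[_ [z _ <-] [zx zy]]|xy].
    by rewrite -(jonesT1_eq T_cont zx).
  apply/asboolP; exists (t x); first by exists x.
  by split=> //; exact: subset_jonesT.
rewrite -sameE; split=> [xy|xy].
  exact/(@eqmodP _ (decomposition_equiv G_dec)).
exact/(@eqmodP _ (decomposition_equiv G_dec)).
Qed.

Lemma decomposition_map_surj (y : decomposition_space G_dec) :
  exists x, q x = y.
Proof. by exists (repr y); exact: reprK. Qed.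

(** Reduces openness and closedness of [q] to the two semicontinuity properties of [t]. *)
Lemma preimage_decomposition_map (A : set X) :
  q @^-1` (q @` A) = [set x | (t x `&` A) !=set0].
Proof.
apply/seteqP; split=> x /=.
  by move=> [a Aa /esym/decomposition_map_eq xa]; exists a.
by move=> [a [/decomposition_map_eq xa Aa]]; exists a.
Qed.

Lemma open_decomposition_map : open_map q.
Proof.
move=> A oA; suff : open (q @^-1` (q @` A)) by [].
by rewrite preimage_decomposition_map; exact: open_jonesT1_meets T_cont _ oA.
Qed.

Lemma closed_decomposition_map : closed_map q.
Proof.
move=> A clA; rewrite -[q @` A]setCK; apply: open_closedC.
suff : open (~` (q @^-1` (q @` A))) by [].
rewrite preimage_decomposition_map.
by apply: closed_openC; exact: closed_jonesT1_meets T_cont _ clA.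
Qed.

Lemma decomposition_space_locally_connected :
  locally_connected (decomposition_space G_dec).
Proof.
move=> y U oU Uy; have [p qp] := decomposition_map_surj y.
pose O := q @^-1` U.
have oO : open O by exact: oU.
(* As [O] is saturated, [nbhs_connected_component] applies at every point of the component of [p],
   which is therefore open; its image under the open map [q] is the required neighborhood. *)
have tO x : O x -> t x `<=` O.
  by move=> Ox z /decomposition_map_eq xz; have : U (q x) by []; rewrite xz.
have Op : O p by rewrite /O /preimage/= qp.
exists (q @` connected_component O p); split.
- apply: open_decomposition_map; rewrite openE => z pz.
  rewrite /interior (same_connected_component pz).
  apply: (nbhs_connected_component T_cont oO); apply: tO.
  exact: connected_component_sub pz.
- apply: connected_continuous_connected; first exact: component_connected.
  by apply: continuous_subspaceT; exact: pi_continuous.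
- by exists p => //; exact: connected_component_refl.
- by move=> _ [x /connected_component_sub Ox <-].
Qed.

End quotient.

Unset Implicit Arguments.

Theorem theorem3p7 (R : realType) (X : metricType R)
    (X_cont : continuum [set: X])
    (T_cont : continuous (@jonesT_hyperspace R X X_cont)) :
  exists D_dec : decomposition (range (fun x : X => jonesT [set x])),
    continuous_decomposition D_dec /\
    locally_connected (decomposition_space D_dec).
Proof.
exists (jonesT1_decomposition T_cont); split; last first.
  exact: decomposition_space_locally_connected T_cont _.
split; first exact: closed_decomposition_map T_cont _.
exact: open_decomposition_map T_cont _.
Qed.
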